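(* For every $r>1$, let $d=\frac12(r+1)$ and let $S_r$ be the operator on $\mathbb{C}\oplus\mathbb{C}\oplus L^2[1,d]\oplus L^2[1,d]$ defined by $$S_r=2(1-d)\oplus0\oplus\begin{pmatrix}D_0-(2d-1)I_0&(D_0-I_0)^{\frac12}(dI_0-D_0)^{\frac12}\\0&(2d-1)(D_0-I_0)\end{pmatrix},$$ where $I_0$ is the identity on $L^2[1,d]$ and $(D_0g)(t)=tg(t)$ for $g\in L^2[1,d]$. Then $W(S_r)$ is neither closed nor open in $\mathbb{C}$.
   Context: The numerical range of an operator $T$ on a Hilbert space is $W(T)=\{\langle Tx,x\rangle:\|x\|=1\}$. In the paper $S_r$ is defined as an element of the $C^*$-algebra $C^*\{Q_r\}\subseteq\mathbb{C}\oplus\{0\}\oplus M_2(C[1,d])$ generated by the idempotent $Q_r=1\oplus0\oplus\begin{pmatrix}D_0&-\ell(D_0)\\\ell(D_0)&I_0-D_0\end{pmatrix}$ with $I_0(t)=1$, $D_0(t)=t$, $\ell(D_0)(t)=\sqrt{t(t-1)}$ in $C[1,d]$; each $f\in C[1,d]$ is identified with multiplication by $f$ on $L^2[1,d]$ (Lebesgue measure), and the second summand $0$ is the zero operator on the second copy of $\mathbb{C}$. *)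

(* Defs.v *)
From HB Require Import structures.
From mathcomp Require Import all_boot all_order all_algebra.
From mathcomp Require Import generic_quotient ring_quotient complex.
From mathcomp Require Import all_classical all_reals all_analysis.
From mathcomp Require Import measurable_realfun.

Set Implicit Arguments.
Unset Strict Implicit.
Unset Printing Implicit Defensive.

Import Order.TTheory GRing.Theory Num.Theory.
Import numFieldNormedType.Exports.

Local Open Scope classical_set_scope.
Local Open Scope ring_scope.
Local Open Scope complex_scope.
Local Open Scope quotient_scope.

Section InnerProductSpaces.
Variable C : numClosedFieldType.

(* An inner product is a library [{dot H for Num.conj}]: linear in its first
   argument, conjugate-linear in the second. *)
Definition ip_norm (H : lmodType C) (ip : {dot H for Num.conj}) (x : H) : C :=
  sqrtC (ip x x).

Definition numerical_range (H : lmodType C) (ip : {dot H for Num.conj})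
  (A : {linear H -> H}) : set C :=
  [set ip (A x) x | x in [set x | ip_norm ip x = 1]].

End InnerProductSpaces.

Section ScalarIP.
Variable C : numClosedFieldType.

(* [C^o] is [C] as a one-dimensional vector space over itself. *)
Definition scalar_ip (z w : C^o) : C := z * Num.conj w.

Let scalar_ip_bilinear : bilinear_for *%R (Num.conj \; *%R) scalar_ip.
Proof.
split=> u a x y; rewrite /scalar_ip /=.
  by rewrite mulrDl -mulrA.
by rewrite rmorphD rmorphM mulrDr mulrCA.
Qed.

HB.instance Definition _ := @bilinear_isBilinear.Build C C^o C^o C
  *%R (Num.conj \; *%R) scalar_ip scalar_ip_bilinear.

Let scalar_ip_herm x y :
  scalar_ip x y = (-1) ^+ false * Num.conj (scalar_ip y x).
Proof. by rewrite /scalar_ip expr0 mul1r rmorphM /= conjCK mulrC. Qed.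

HB.instance Definition _ := @isHermitianSesquilinear.Build C C^o false
  Num.conj scalar_ip scalar_ip_herm.

Let scalar_ip_gt0 x : x != 0 -> 0 < scalar_ip x x.
Proof. by move=> x0; rewrite /scalar_ip mul_conjC_gt0. Qed.

HB.instance Definition _ := @isDotProduct.Build C C^o scalar_ip
  scalar_ip_gt0.

End ScalarIP.

Section DirectSum.
Variables (C : numClosedFieldType) (U V : lmodType C).

Section IP.
Variables (ipU : {dot U for Num.conj}) (ipV : {dot V for Num.conj}).

Definition dsum_ip (x y : U * V) : C := ipU x.1 y.1 + ipV x.2 y.2.

Let dsum_ip_bilinear : bilinear_for *%R (Num.conj \; *%R) dsum_ip.
Proof.
split=> u a x y; rewrite /dsum_ip /=.
  by rewrite !linearPl /= mulrDr addrACA.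
by rewrite !linearPr /= mulrDr addrACA.
Qed.

HB.instance Definition _ := @bilinear_isBilinear.Build C (U * V)%type
  (U * V)%type C *%R (Num.conj \; *%R) dsum_ip dsum_ip_bilinear.

Let dsum_ip_herm x y : dsum_ip x y = (-1) ^+ false * Num.conj (dsum_ip y x).
Proof.
rewrite /dsum_ip expr0 mul1r rmorphD /=.
by rewrite [ipU x.1 _]hermC [ipV x.2 _]hermC !expr0 !mul1r.
Qed.

HB.instance Definition _ := @isHermitianSesquilinear.Build C (U * V)%type false
  Num.conj dsum_ip dsum_ip_herm.

Let dsum_ip_gt0 x : x != 0 -> 0 < dsum_ip x x.
Proof.
case: x => u v; rewrite /dsum_ip /= -pair_eqE /= negb_and.
by case: (eqVneq u 0) => [->|u0] /= v0; [rewrite linear0r add0r|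
  case: (eqVneq v 0) => [->|v0']; [rewrite linear0r addr0|rewrite addr_gt0 //]];
  exact: neq0_dnorm_gt0.
Qed.

HB.instance Definition _ := @isDotProduct.Build C (U * V)%type dsum_ip
  dsum_ip_gt0.
End IP.

Definition dsum_op (A : {linear U -> U}) (B : {linear V -> V}) (x : U * V) :
  U * V := (A x.1, B x.2).

Let dsum_op_linear A B : linear (dsum_op A B).
Proof. by move=> a x y; rewrite /dsum_op /= !linearP. Qed.

HB.instance Definition _ A B :=
  GRing.isLinear.Build C (U * V)%type (U * V)%type *:%R (dsum_op A B)
    (dsum_op_linear A B).

Definition block_op (A : {linear U -> U}) (B : {linear V -> U})
    (B' : {linear U -> V}) (D : {linear V -> V}) (x : U * V) : U * V :=
  (A x.1 + B x.2, B' x.1 + D x.2).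

Let block_op_linear A B B' D : linear (block_op A B B' D).
Proof.
by move=> a x y; congr pair; rewrite /= !linearP /= scalerDr addrACA.
Qed.

HB.instance Definition _ A B B' D :=
  GRing.isLinear.Build C (U * V)%type (U * V)%type *:%R (block_op A B B' D)
    (block_op_linear A B B' D).

End DirectSum.

Section SquareIntegrable.
Context (d : measure_display) (T : measurableType d) (R : realType).
Variable mu : {measure set T -> \bar R}.
Local Notation C := R[i].

(* The library's [Lfun] consists of real-valued functions; a complex function
   is p-integrable iff its real and imaginary parts are. *)
Definition complex_Lfun (p : \bar R) : {pred T -> C} :=
  [pred f | ((@complex.Re R \o f) \in Lfun mu p) && ((@complex.Im R \o f) \in Lfun mu p)].

Definition complex_integral (f : T -> C) : C :=
  (\int[mu]_x complex.Re (f x))%R +i* (\int[mu]_x complex.Im (f x))%R.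

Let Lfun_ext (p : \bar R) (f g : T -> R) :
  f =1 g -> f \in Lfun mu p -> g \in Lfun mu p.
Proof. by move=> /funext ->. Qed.

Let Lfun_lin (p : \bar R) (p1 : (1 <= p)%E) (a b : R) (f g : T -> R) :
  f \in Lfun mu p -> g \in Lfun mu p ->
  (fun x => a * f x + b * g x) \in Lfun mu p.
Proof.
move=> fL gL; have [L0 L] := Lfun_submod_closed mu p1.
have -> : (fun x => a * f x + b * g x) = a *: f + (b *: g + 0).
  by apply/funext => x; rewrite addr0.
by apply: (L) => //; apply: (L).
Qed.

Lemma complex_Lfun_submod_closed (p : \bar R) : (1 <= p)%E ->
  submod_closed (complex_Lfun p).
Proof.
move=> p1; have [L0 _] := Lfun_submod_closed mu p1.
split; first by rewrite inE; apply/andP; split; exact: L0.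
move=> [a b] f g /andP[rf imf] /andP[rg img].
have H := Lfun_lin p1.
apply/andP; split.
- apply: (Lfun_ext _ (H 1 1 _ _ (H a (- b) _ _ rf imf) rg)) => x.
  rewrite !mul1r -[RHS]/(complex.Re ((a +i* b) * f x + g x)) /=.
  by case: (f x) (g x) => ? ? [? ?] /=; rewrite mulNr.
- apply: (Lfun_ext _ (H 1 1 _ _ (H a b _ _ imf rf) img)) => x.
  rewrite !mul1r -[RHS]/(complex.Im ((a +i* b) * f x + g x)) /=.
  by case: (f x) (g x) => ? ? [? ?].
Qed.

Lemma complex_integral_lin (a : C) (f g : T -> C) :
  f \in complex_Lfun 1 -> g \in complex_Lfun 1 ->
  complex_integral (fun x => a * f x + g x) =
  a * complex_integral f + complex_integral g.
Proof.
move=> /andP[rf imf] /andP[rg img].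
have RI u v (r s : R) : u \in Lfun mu 1 -> v \in Lfun mu 1 ->
    (\int[mu]_x (r * u x + s * v x) =
     r * \int[mu]_x u x + s * \int[mu]_x v x)%R.
  move=> uL vL.
  have Z (w : T -> R) (t : R) : w \in Lfun mu 1 ->
      mu.-integrable setT (EFin \o (fun x => t * w x)).
    move=> wL; apply/Lfun1_integrable.
    apply: (Lfun_ext _ (Lfun_lin (lexx 1%E) t 0 wL wL)) => x.
    by rewrite mul0r addr0.
  rewrite RintegralD//; [|exact: Z..].
  by rewrite !RintegralZl//; exact/Lfun1_integrable.
have H := @Lfun_lin 1%E (lexx 1%E).
case: a => a b.
have -> : (fun x => (a +i* b) * f x + g x) = (fun x =>
   (1 * (a * complex.Re (f x) + (- b) * complex.Im (f x)) + 1 * complex.Re (g x)) +i*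
   (1 * (a * complex.Im (f x) + b * complex.Re (f x)) + 1 * complex.Im (g x))).
  apply/funext => x; rewrite !mul1r.
  by case: (f x) (g x) => ? ? [? ?]; rewrite mulNr.
rewrite /complex_integral /=.
rewrite (RI _ _ 1 1 (H a (- b) _ _ rf imf) rg) (RI _ _ a (- b) rf imf).
rewrite (RI _ _ 1 1 (H a b _ _ imf rf) img) (RI _ _ a b imf rf).
by rewrite !mul1r mulNr.
Qed.

Lemma complex_integral_conj (f : T -> C) : f \in complex_Lfun 1 ->
  complex_integral (fun x => Num.conj (f x)) = Num.conj (complex_integral f).
Proof.
move=> /andP[rf imf]; rewrite /complex_integral.
congr (_ +i* _); first by congr Rintegral; apply/funext => x; case: (f x).
have <- : (\int[mu]_x ((-1) * complex.Im (f x)) = - \int[mu]_x complex.Im (f x))%R.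
  rewrite RintegralZl ?mulN1r//; exact/Lfun1_integrable.
by congr Rintegral; apply/funext => x; case: (f x) => ? ?; rewrite mulN1r.
Qed.

Lemma complex_LfunM (f g : T -> C) :
  f \in complex_Lfun 2 -> g \in complex_Lfun 2 ->
  (fun x => f x * Num.conj (g x)) \in complex_Lfun 1.
Proof.
move=> /andP[rf imf] /andP[rg img].
have H := @Lfun_lin 1%E (lexx 1%E).
have M := @Lfun2_mul_Lfun1 _ _ _ mu.
apply/andP; split.
- apply: (Lfun_ext _ (H 1 1 _ _ (M _ _ rf rg) (M _ _ imf img))) => x /=; rewrite !mul1r.
  by case: (f x) (g x) => ? ? [? ?] /=; rewrite mulrN opprK.
- apply: (Lfun_ext _ (H (- 1) 1 _ _ (M _ _ rf img) (M _ _ imf rg))) => x /=; rewrite mul1r mulN1r.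
  by case: (f x) (g x) => ? ? [? ?] /=; rewrite mulrN.
Qed.

Lemma eq_ae_complex_integral (f g : T -> C) :
  f \in complex_Lfun 1 -> g \in complex_Lfun 1 -> f = g %[ae mu] ->
  complex_integral f = complex_integral g.
Proof.
move=> /andP[rf imf] /andP[rg img] fg.
have E (u v : T -> R) : u \in Lfun mu 1 -> v \in Lfun mu 1 ->
    u = v %[ae mu] -> (\int[mu]_x u x = \int[mu]_x v x)%R.
  move=> /Lfun1_integrable/measurable_int mu_u.
  move=> /Lfun1_integrable/measurable_int mu_v uv.
  congr fine; apply: ae_eq_integral => //.
  by apply: filterS uv => x /(_ Logic.I) /= ->.
by congr (_ +i* _); apply: E => //; apply: filterS fg => x /= h /h ->.
Qed.

(* Square-integrable functions, before identification up to null sets. *)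
Record sqint := SqInt {
  sqint_fun :> T -> C ;
  _ : sqint_fun \in complex_Lfun 2 }.

HB.instance Definition _ := [isSub for sqint_fun].
HB.instance Definition _ := [Choice of sqint by <:].

Let complex_Lfun2_closed := complex_Lfun_submod_closed (lee1n 2 : (1 <= 2)%E).
HB.instance Definition _ :=
  GRing.isSubmodClosed.Build C (T -> C) (complex_Lfun 2) complex_Lfun2_closed.
HB.instance Definition _ := [SubChoice_isSubLmodule of sqint by <:].

End SquareIntegrable.

Section L2.
Context (d : measure_display) (T : measurableType d) (R : realType).
Variable mu : {measure set T -> \bar R}.
Local Notation C := R[i].
Local Notation sqint := (sqint mu).

Definition ae_null : {pred sqint} :=
  [pred f : sqint | `[< (f : T -> C) = cst 0 %[ae mu] >]].

Lemma ae_null_submod_closed : submod_closed ae_null.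
Proof.
split; first by apply/asboolP; apply: filterE => x _.
move=> a f g /asboolP f0 /asboolP g0; apply/asboolP.
apply: filterS2 f0 g0 => x f0 g0 _.
rewrite -[LHS]/(a * f x + g x) (f0 Logic.I) (g0 Logic.I).
by rewrite mulr0 addr0.
Qed.

HB.instance Definition _ :=
  GRing.isSubmodClosed.Build C sqint ae_null ae_null_submod_closed.

Definition L2 : Type := {ideal_quot ae_null}.
HB.instance Definition _ := GRing.Zmodule.on L2.
HB.instance Definition _ := Quotient.on L2.

Definition L2_class (f : sqint) : L2 := \pi_{ideal_quot ae_null} f.

Lemma L2_classP (f g : sqint) :
  L2_class f = L2_class g <-> (f : T -> C) = g %[ae mu].
Proof.
split=> [/eqP|fg].
  rewrite /L2_class -Quotient.idealrBE => /asboolP; apply: filterS => x fg _.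
  by apply/eqP; rewrite -subr_eq0; apply/eqP; exact: fg.
apply/eqP; rewrite /L2_class -Quotient.idealrBE; apply/asboolP.
apply: filterS fg => x fg _.
by rewrite -[LHS]/(f x - g x) fg// subrr.
Qed.

Lemma L2_classK (x : L2) : L2_class (repr x) = x.
Proof. exact: reprK. Qed.

End L2.

Section L2_lmodule.
Context (d : measure_display) (T : measurableType d) (R : realType).
Variable mu : {measure set T -> \bar R}.
Local Notation C := R[i].
Local Notation L2 := (L2 mu).
Local Notation sqint := (sqint mu).

Lemma repr_L2_class (f : sqint) :
  (repr (L2_class f) : T -> C) = f %[ae mu].
Proof. by apply/L2_classP; rewrite L2_classK. Qed.

Definition L2_scale (a : C) (x : L2) : L2 := L2_class (a *: repr x).

Let L2_scaleE a (f : sqint) : L2_scale a (L2_class f) = L2_class (a *: f).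
Proof.
apply/L2_classP; apply: filterS (repr_L2_class f) => x fE _.
by rewrite -[LHS]/(a * repr (L2_class f) x) fE.
Qed.

Let L2_classD (f g : sqint) : L2_class (f + g) = L2_class f + L2_class g.
Proof. by rewrite /L2_class raddfD. Qed.

Let L2_scaleA a b x : L2_scale a (L2_scale b x) = L2_scale (a * b) x.
Proof. by rewrite -(L2_classK x) !L2_scaleE scalerA. Qed.

Let L2_scale1 : left_id 1 L2_scale.
Proof. by move=> x; rewrite -(L2_classK x) L2_scaleE scale1r. Qed.

Let L2_scaleDr : right_distributive L2_scale +%R.
Proof.
move=> a x y; rewrite -(L2_classK x) -(L2_classK y) !L2_scaleE -!L2_classD.
by rewrite L2_scaleE scalerDr.
Qed.

Let L2_scaleDl x : {morph L2_scale^~ x : a b / a + b}.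
Proof.
by move=> a b; rewrite -(L2_classK x) !L2_scaleE -L2_classD scalerDl.
Qed.

HB.instance Definition _ := GRing.Zmodule_isLmodule.Build C L2
  L2_scaleA L2_scale1 L2_scaleDr L2_scaleDl.

Let L2_class_linear : linear (@L2_class _ T R mu).
Proof. by move=> a f g; rewrite L2_classD -L2_scaleE. Qed.

HB.instance Definition _ := GRing.isLinear.Build C sqint L2 *:%R
  (@L2_class _ T R mu) L2_class_linear.

Definition L2_ip (x y : L2) : C :=
  complex_integral mu (fun t => repr x t * Num.conj (repr y t)).

Lemma L2_ipE (f g : sqint) : L2_ip (L2_class f) (L2_class g) =
  complex_integral mu (fun t => f t * Num.conj (g t)).
Proof.
apply: eq_ae_complex_integral; [exact: complex_LfunM (valP _) (valP _)..|].
apply: filterS2 (repr_L2_class f) (repr_L2_class g) => x fE gE _.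
by rewrite fE// gE.
Qed.

Let L2_ip_lin x : GRing.linear_for *%R (L2_ip^~ x).
Proof.
move=> a u v; rewrite -(L2_classK x) -(L2_classK u) -(L2_classK v).
move: (repr x) (repr u) (repr v) => {x u v} h f g.
rewrite -linearP !L2_ipE -complex_integral_lin;
  [|exact: complex_LfunM (valP _) (valP _)..].
congr complex_integral; apply/funext => x.
by rewrite -[(a *: f + g) x]/(a * f x + g x) mulrDl mulrA.
Qed.

Let L2_ip_herm x y : L2_ip x y = (-1) ^+ false * Num.conj (L2_ip y x).
Proof.
rewrite expr0 mul1r -complex_integral_conj;
  last exact: complex_LfunM (valP _) (valP _).
congr complex_integral; apply/funext => t.
by rewrite rmorphM /= conjCK mulrC.
Qed.

Let L2_ip_bilinear : bilinear_for *%R (Num.conj \; *%R) L2_ip.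
Proof.
split=> [x|x a u v]; first exact: L2_ip_lin.
have H := L2_ip_herm; rewrite expr0 in H.
rewrite H L2_ip_lin (H x u) (H x v) !mul1r /=.
by rewrite rmorphD rmorphM.
Qed.

HB.instance Definition _ := @bilinear_isBilinear.Build C L2 L2 C
  *%R (Num.conj \; *%R) L2_ip L2_ip_bilinear.

HB.instance Definition _ := @isHermitianSesquilinear.Build C L2 false
  Num.conj L2_ip L2_ip_herm.

Let L2_ip_gt0 x : x != 0 -> 0 < L2_ip x x.
Proof.
rewrite -(L2_classK x); move: (repr x) => {x} f f0.
have [/andP[rf imf]] : (f : T -> C) \in complex_Lfun mu 2 by exact: valP.
have sq_int (u : T -> R) : u \in Lfun mu 2 ->
    mu.-integrable setT (EFin \o (fun x => u x ^+ 2)).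
  exact: Lfun2_integrable_sqr.
pose F x := complex.Re (f x) ^+ 2 + complex.Im (f x) ^+ 2.
have F0 x : 0 <= F x by rewrite addr_ge0 ?sqr_ge0.
have iF : mu.-integrable setT (EFin \o F).
  exact: (integrableD measurableT (sq_int _ rf) (sq_int _ imf)).
have -> : L2_ip (L2_class f) (L2_class f) = (\int[mu]_x F x)%R%:C.
  rewrite L2_ipE /complex_integral; congr (_ +i* _).
    congr Rintegral; apply/funext => x; rewrite /F.
    by case: (f x) => a b /=; rewrite mulrN opprK.
  rewrite (_ : (fun x => _) = cst 0) ?Rintegral_cst ?mul0r//.
  apply/funext => x; case: (f x) => a b /=.
  by rewrite mulrN (mulrC b) addNr.
rewrite ltcR lt_neqAle Rintegral_ge0 ?andbT//.
apply: contra f0 => /eqP/esym int0.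
apply/eqP; rewrite -(linear0 (@L2_class _ T R mu)); apply/L2_classP.
have : (\int[mu]_x (F x)%:E = 0)%E.
  by rewrite -[LHS]fineK ?integral_fune_fin_num//; congr EFin.
have /integrableP[mF _] := iF.
under eq_integral do rewrite -[(_)%:E]gee0_abs ?lee_fin//.
move/(ae_eq_integral_abs mu measurableT mF).
apply: filterS => x /(_ Logic.I) [] Fx _.
move/eqP: Fx; rewrite /F paddr_eq0 ?sqr_ge0// !sqrf_eq0.
by case: (f x) => a b /= /andP[/eqP -> /eqP ->].
Qed.

HB.instance Definition _ := @isDotProduct.Build C L2 L2_ip L2_ip_gt0.

End L2_lmodule.

Section MultiplicationOperators.
Context (R : realType) (a b : R).
Local Notation C := R[i].

(* Lebesgue measure restricted to [a, b]; since the complement of [a, b] is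
   null for it, [L2 lebesgue_on] is L^2[a, b]. *)
Definition lebesgue_on : {measure set (measurableTypeR R) -> \bar R} :=
  mrestr (@lebesgue_measure R) (measurable_itv `[a, b]%R).

Local Notation L2ab := (L2 lebesgue_on).
Variable m : R -> R.
Hypothesis cm : {within `[a, b], continuous m}.

Let m_meas : measurable_fun [set: measurableTypeR R] (m \_ `[a, b]).
Proof.
apply/(measurable_restrictT _ (measurable_itv `[a, b]%R)).
exact: subspace_continuous_measurable_fun.
Qed.

Let m_bounded : exists2 K : R, 0 <= K & forall t, `|(m \_ `[a, b]) t| <= K.
Proof.
have [ab|ba] := leP a b.
  have [u _ mu_] := EVT_max ab cm; have [l _ ml] := EVT_min ab cm.
  exists (Num.max `|m u| `|m l|); first by rewrite le_max normr_ge0.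
  move=> t; rewrite patchE; case: ifPn => [/set_mem tab|_].
    rewrite le_max; have [mt|mt] := leP 0 (m t).
      by rewrite ger0_norm// (le_trans (mu_ _ tab)) ?ler_norm.
    rewrite ltr0_norm//; apply/orP; right.
    by rewrite -normrN (le_trans _ (ler_norm _))// lerN2 ml.
  by rewrite normr0 le_max normr_ge0.
exists 0 => // t; rewrite patchE set_itv_ge ?bnd_simp -?ltNge//.
by rewrite in_set0 normr0.
Qed.

Let mul_Lfun (u : R -> R) : u \in Lfun lebesgue_on 2 ->
  (fun t => (m \_ `[a, b]) t * u t) \in Lfun lebesgue_on 2.
Proof.
move=> uL; have [K K0 mK] := m_bounded.
have KL : K \o* u \in Lfun lebesgue_on 2%:E by apply: Lfun_scale => //; rewrite ler1n.
move: uL KL; rewrite !inE => /andP[mu_ _] /andP[mKu fKu].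
move: mu_ mKu; rewrite !inE /= => mu_ mKu.
have mm : measurable_fun [set: measurableTypeR R]
    (fun t => (m \_ `[a, b]) t * u t) by exact: measurable_funM.
apply/andP; split; rewrite inE//=.
move: fKu; rewrite inE /= /finite_norm; apply: le_lt_trans.
rewrite unlock.
have mp (v : R -> R) : measurable_fun [set: measurableTypeR R] v ->
    measurable_fun [set: measurableTypeR R] (fun t => (`|(v t)%:E| `^ 2)%E).
  move=> mv.
  under eq_fun do rewrite abse_EFin poweR_EFin.
  apply/measurable_EFinP.
  apply/(@measurableT_comp _ _ _ _ _ _ (fun x : R => x `^ 2)%R) => //.
  exact/measurableT_comp.
rewrite gt0_ler_poweR//.
- by rewrite in_itv/= leey integral_ge0// => x _; rewrite poweR_ge0.
- by rewrite in_itv/= leey integral_ge0// => x _; rewrite poweR_ge0.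
apply: ge0_le_integral => //.
- by move=> x _; rewrite poweR_ge0.
- exact: mp.
- exact: mp.
- move=> x _; rewrite gt0_ler_poweR// ?in_itv/= ?leey ?andbT ?lee_fin//.
  by rewrite !normrM mulrC ler_wpM2l// (le_trans (mK _))// ler_norm.
Qed.

Let mul_complex_Lfun (f : R -> C) : f \in complex_Lfun lebesgue_on 2 ->
  (fun t => ((m \_ `[a, b]) t)%:C * f t) \in complex_Lfun lebesgue_on 2.
Proof.
move=> /andP[/mul_Lfun rf /mul_Lfun imf].
apply/andP; split.
- rewrite (_ : _ \o _ = fun t => (m \_ `[a, b]) t * complex.Re (f t))//.
  by apply/funext => t /=; case: (f t) => x y /=; rewrite mul0r subr0.
- rewrite (_ : _ \o _ = fun t => (m \_ `[a, b]) t * complex.Im (f t))//.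
  by apply/funext => t /=; case: (f t) => x y /=; rewrite mul0r addr0.
Qed.

(* [m] is only assumed continuous on [a, b]; extending it by 0 outside keeps
   the product measurable and does not change its class. *)
Definition mul_sqint (f : sqint lebesgue_on) : sqint lebesgue_on :=
  SqInt (mul_complex_Lfun (valP f)).

Definition mul_op (x : L2ab) : L2ab := L2_class (mul_sqint (repr x)).

Lemma mul_opE (f : sqint lebesgue_on) :
  mul_op (L2_class f) = L2_class (mul_sqint f).
Proof.
apply/L2_classP; apply: filterS (repr_L2_class f) => t ft _.
by rewrite /= ft.
Qed.

Let mul_op_linear : linear mul_op.
Proof.
move=> c x y; rewrite -(L2_classK x) -(L2_classK y) -linearP !mul_opE -linearP.
congr L2_class; apply: val_inj; apply/funext => t /=.
move: (repr x) (repr y) => f g.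
rewrite -[LHS]/(((m \_ `[a, b]) t)%:C * (c * f t + g t)).
rewrite -[RHS]/(c * (((m \_ `[a, b]) t)%:C * f t) + ((m \_ `[a, b]) t)%:C * g t).
by rewrite mulrDr mulrCA.
Qed.

HB.instance Definition _ := GRing.isLinear.Build C L2ab L2ab *:%R
  mul_op mul_op_linear.

End MultiplicationOperators.

Section OperatorS.
Context (R : realType) (d : R).
Local Notation C := R[i].
Local Notation L2d := (L2 (lebesgue_on 1 d)).

Definition D0 : R -> R := id.
Definition I0 : R -> R := cst 1.

(* The entries of the 2x2 block as elements of C[1, d]; square roots there are
   pointwise, and both radicands are nonnegative on [1, d]. *)
Definition S_entry11 : R -> R := D0 - (2 * d - 1) *: I0.
Definition S_entry12 : R -> R :=
  (Num.sqrt \o (D0 - I0)) \* (Num.sqrt \o (d *: I0 - D0)).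
Definition S_entry22 : R -> R := (2 * d - 1) *: (D0 - I0).

Lemma S_entry11_continuous : {within `[1, d], continuous S_entry11}.
Proof.
apply: continuous_subspaceT => t.
by apply: cvgB; [exact: cvg_id | apply: cvgZr; exact: cvg_cst].
Qed.

Lemma S_entry12_continuous : {within `[1, d], continuous S_entry12}.
Proof.
apply: continuous_subspaceT => t.
apply: cvgM; apply: continuous_comp; try exact: sqrt_continuous.
  by apply: cvgB; [exact: cvg_id | exact: cvg_cst].
by apply: cvgB; [apply: cvgZr; exact: cvg_cst | exact: cvg_id].
Qed.

Lemma S_entry22_continuous : {within `[1, d], continuous S_entry22}.
Proof.
apply: continuous_subspaceT => t; apply: cvgZr.
by apply: cvgB; [exact: cvg_id | exact: cvg_cst].
Qed.

Definition S_space : lmodType C := ((C^o * C^o) * (L2d * L2d))%type.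

Definition S_ip : {dot S_space for Num.conj} :=
  dsum_ip (dsum_ip (@scalar_ip C) (@scalar_ip C))
    (dsum_ip (@L2_ip _ _ R (lebesgue_on 1 d)) (@L2_ip _ _ R (lebesgue_on 1 d))).

Definition S_op : {linear S_space -> S_space} :=
  dsum_op
    (dsum_op ( *:%R (2 * (1 - d))%:C : {linear C^o -> C^o}) (\0 : {linear C^o -> C^o}))
    (block_op (mul_op S_entry11_continuous) (mul_op S_entry12_continuous)
              \0                            (mul_op S_entry22_continuous)).

End OperatorS.

(* Main.v *)
Require Import Defs.
From mathcomp Require Import all_boot all_order all_algebra.
From mathcomp Require Import complex ring lra.
From mathcomp Require Import all_classical all_reals all_analysis.
From mathcomp Require Import measurable_realfun.
Import Order.TTheory GRing.Theory Num.Theory.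
Import numFieldNormedType.Exports.
Local Open Scope classical_set_scope.
Local Open Scope ring_scope.

(** The 2x2 block of [S_r] acts fibrewise by upper triangular matrices [A t],
    [1 <= t <= d]. Completing squares shows that the Hermitian part of [A t]
    lies between [2 (1 - d)] and [(2 d - 1) (d - 1)], strictly below the latter
    unless [t = d]. The lower bound is the eigenvalue of the first summand, so
    it is an extreme point belonging to the numerical range, which is therefore
    not open. The upper bound is not attained because the fibre [t = d] is
    null, but it is a limit of values at vectors of the last summand
    concentrated near [t = d], so the numerical range is not closed. *)

(** * The real part of the quadratic form as an integral over fibres *)

Definition sqnorm {R : realType} (z : R[i]) : R :=
  complex.Re z ^+ 2 + complex.Im z ^+ 2.

(* The contribution of the fibre at [t] to the real part of [<S x, x>]; it
   vanishes outside [1, d]. *)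
Definition S_density {R : realType} (d : R) (f g : R -> R[i]) (t : R) : R :=
  (S_entry11 d \_ `[1, d]) t * sqnorm (f t)
  + (S_entry12 d \_ `[1, d]) t * complex.Re (g t * Num.conj (f t))
  + (S_entry22 d \_ `[1, d]) t * sqnorm (g t).

Lemma Re_scale_conj {R : realType} (c : R) (z w : R[i]) :
  complex.Re (c%:C%C * z * Num.conj w) = c * complex.Re (z * Num.conj w).
Proof. by case: z w => [? ?] [? ?] /=; ring. Qed.

Lemma Re_mul_conj {R : realType} (z : R[i]) :
  complex.Re (z * Num.conj z) = sqnorm z.
Proof. by case: z => [? ?]; rewrite /sqnorm /=; ring. Qed.

Lemma sqnorm_ge0 {R : realType} (z : R[i]) : 0 <= sqnorm z.
Proof. by rewrite addr_ge0 ?sqr_ge0. Qed.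

Lemma integrable_Re_mul_conj {R : realType} {d} {T : measurableType d}
    {mu : {measure set T -> \bar R}} (f g : sqint mu) :
  mu.-integrable setT (EFin \o (fun t => complex.Re (f t * Num.conj (g t)))).
Proof.
have /andP[/Lfun1_integrable + _] := complex_LfunM (valP f) (valP g).
exact.
Qed.

(** Naming a vector by square-integrable representatives turns inner products into integrals of
    functions; by [S_vectorP] every vector has this form. *)
Definition S_vector {R : realType} {d : R} (a b : R[i])
  (f g : sqint (lebesgue_on 1 d)) : S_space d :=
  ((a, b), (L2_class f, L2_class g)).

Lemma S_ip_opE {R : realType} (d : R) (a b : R[i])
    (f g : sqint (lebesgue_on 1 d)) :
  S_ip d (S_op d (S_vector a b f g)) (S_vector a b f g) =
  (2 * (1 - d))%:C%C * (a * Num.conj a)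
  + (complex_integral (lebesgue_on 1 d) (fun t =>
      (((S_entry11 d \_ `[1, d]) t)%:C%C * f t
       + ((S_entry12 d \_ `[1, d]) t)%:C%C * g t)
       * Num.conj (f t))
  + complex_integral (lebesgue_on 1 d) (fun t =>
       ((S_entry22 d \_ `[1, d]) t)%:C%C * g t * Num.conj (g t))).
Proof.
pose m11 := mul_sqint (@S_entry11_continuous R d).
pose m12 := mul_sqint (@S_entry12_continuous R d).
pose m22 := mul_sqint (@S_entry22_continuous R d).
transitivity (scalar_ip ((2 * (1 - d))%:C%C *: (a : R[i]^o)) a + scalar_ip 0 b
  + (L2_ip (L2_class (m11 f + m12 g)) (L2_class f)
     + L2_ip (L2_class (m22 g)) (L2_class g))).
  have -> : L2_class (m11 f + m12 g) =
      mul_op (@S_entry11_continuous R d) (L2_class f)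
      + mul_op (@S_entry12_continuous R d) (L2_class g)
    by rewrite !mul_opE -linearD.
  (* The summand [0] is the lower left entry of the block, kept so that the two sides agree by
     conversion. *)
  have -> : L2_class (m22 g) =
      0 + mul_op (@S_entry22_continuous R d) (L2_class g).
    by rewrite mul_opE add0r.
  reflexivity.
by rewrite !L2_ipE /scalar_ip mul0r addr0 -mulrA.
Qed.

Lemma S_ip_diagE {R : realType} (d : R) (a b : R[i])
    (f g : sqint (lebesgue_on 1 d)) :
  S_ip d (S_vector a b f g) (S_vector a b f g) =
  a * Num.conj a + b * Num.conj b
  + (complex_integral (lebesgue_on 1 d) (fun t => f t * Num.conj (f t))
     + complex_integral (lebesgue_on 1 d) (fun t => g t * Num.conj (g t))).
Proof. by rewrite -!L2_ipE. Qed.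

Lemma S_vectorP {R : realType} (d : R) (x : S_space d) :
  exists a b f g, x = S_vector a b f g.
Proof.
case: x => -[a b] [f g]; exists a, b, (repr f), (repr g).
by rewrite /S_vector !L2_classK.
Qed.

Lemma integrable_S_density {R : realType} (d : R)
    (f g : sqint (lebesgue_on 1 d)) :
  (lebesgue_on 1 d).-integrable setT (EFin \o S_density d f g).
Proof.
pose m11 := mul_sqint (@S_entry11_continuous R d).
pose m12 := mul_sqint (@S_entry12_continuous R d).
pose m22 := mul_sqint (@S_entry22_continuous R d).
(* Regrouped as real parts of two products of square-integrable functions, the density is visibly
   integrable. *)
have -> : S_density d f g = fun t =>
   complex.Re ((m11 f + m12 g) t * Num.conj (f t))
   + complex.Re (m22 g t * Num.conj (g t)).
  apply/funext => t; rewrite -[(m11 f + m12 g) t]/(m11 f t + m12 g t).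
  by rewrite mulrDl raddfD /= !Re_scale_conj !Re_mul_conj.
exact: (integrableD measurableT (integrable_Re_mul_conj _ _)
  (integrable_Re_mul_conj _ _)).
Qed.

Lemma Re_S_ip_op {R : realType} (d : R) (a b : R[i])
    (f g : sqint (lebesgue_on 1 d)) :
  complex.Re (S_ip d (S_op d (S_vector a b f g)) (S_vector a b f g)) =
  2 * (1 - d) * sqnorm a + \int[lebesgue_on 1 d]_t S_density d f g t.
Proof.
pose m11 := mul_sqint (@S_entry11_continuous R d).
pose m12 := mul_sqint (@S_entry12_continuous R d).
pose m22 := mul_sqint (@S_entry22_continuous R d).
rewrite S_ip_opE !raddfD /= mulrA Re_scale_conj Re_mul_conj; congr (_ + _).
rewrite -RintegralD//.
- apply: eq_Rintegral => t _.
  by rewrite mulrDl raddfD /= !Re_scale_conj !Re_mul_conj.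
- exact: (integrable_Re_mul_conj (m11 f + m12 g) f).
- exact: (integrable_Re_mul_conj (m22 g) g).
Qed.

Lemma integrable_sqnorm {R : realType} {d} {T : measurableType d}
    {mu : {measure set T -> \bar R}} (f : sqint mu) :
  mu.-integrable setT (EFin \o (fun t => sqnorm (f t))).
Proof.
have := integrable_Re_mul_conj f f.
by congr (integrable _ _ _); apply/funext => t /=; rewrite Re_mul_conj.
Qed.

Lemma Re_S_ip_diag {R : realType} (d : R) (a b : R[i])
    (f g : sqint (lebesgue_on 1 d)) :
  complex.Re (S_ip d (S_vector a b f g) (S_vector a b f g)) =
  sqnorm a + sqnorm b + \int[lebesgue_on 1 d]_t (sqnorm (f t) + sqnorm (g t)).
Proof.
rewrite S_ip_diagE !raddfD /= !Re_mul_conj; congr (_ + _).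
rewrite RintegralD//; try exact: integrable_sqnorm.
by congr (_ + _); apply: eq_Rintegral => t _; rewrite Re_mul_conj.
Qed.

(** * Bounds for the quadratic form on each fibre *)

(* Here [x] and [y] stand for [sqrt (t - 1)] and [sqrt (d - t)]. *)
Lemma fibre_form_ge {R : realType} (d x y p u : R) :
  1 < d -> x ^+ 2 + y ^+ 2 = d - 1 ->
  2 * (1 - d) * (p ^+ 2 + u ^+ 2) <=
  (x ^+ 2 + 2 * (1 - d)) * p ^+ 2 + x * y * (u * p)
  + (2 * d - 1) * x ^+ 2 * u ^+ 2.
Proof.
move=> d1 xy; rewrite -subr_ge0.
have -> : (x ^+ 2 + 2 * (1 - d)) * p ^+ 2 + x * y * (u * p)
    + (2 * d - 1) * x ^+ 2 * u ^+ 2 - 2 * (1 - d) * (p ^+ 2 + u ^+ 2) =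
    (x * p + y * u / 2) ^+ 2
    + ((2 * d - 1) * x ^+ 2 + 2 * (d - 1) - y ^+ 2 / 4) * u ^+ 2 by field.
(* The coefficient of [u ^+ 2] is nonnegative because [y ^+ 2] is at most [d - 1]. *)
rewrite addr_ge0 ?sqr_ge0// mulr_ge0 ?sqr_ge0//.
have := sqr_ge0 x; have := sqr_ge0 y.
have : 0 <= (2 * d - 1) * x ^+ 2 by rewrite mulr_ge0 ?sqr_ge0//; lra.
lra.
Qed.

(** Since [d - 1 - x ^+ 2 = y ^+ 2], the gap has [u ^+ 2] coefficient [(2 * d - 1) * y ^+ 2]; the
    factor [4 * (2 * d - 1)] lets the square be completed without division. As [c] is positive, a
    zero gap forces [p = 0], and then [u = 0] when [y] is nonzero. *)
Lemma fibre_form_gap {R : realType} (d x y p u : R) :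
  1 < d -> x ^+ 2 + y ^+ 2 = d - 1 ->
  exists2 c, 0 < c &
  4 * (2 * d - 1) * ((2 * d - 1) * (d - 1) * (p ^+ 2 + u ^+ 2)
  - ((x ^+ 2 + 2 * (1 - d)) * p ^+ 2 + x * y * (u * p)
     + (2 * d - 1) * x ^+ 2 * u ^+ 2))
  = (2 * (2 * d - 1) * y * u - x * p) ^+ 2 + c * p ^+ 2.
Proof.
move=> d1 xy.
(* This is what remains of the [p ^+ 2] coefficient. It decreases in [x ^+ 2], which is at most
   [d - 1], so it is at least [(d - 1) * (8 * d * (2 * d - 1) - 1)], which is positive. *)
exists (4 * (2 * d - 1) * ((2 * d - 1) * d - (x ^+ 2 + 1)) - x ^+ 2).
  have : 0 < (d - 1) * (d - 1) by rewrite mulr_gt0// subr_gt0.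
  have := sqr_ge0 x; have := sqr_ge0 y.
  move: xy; set X := x ^+ 2; set Y := y ^+ 2 => xy Y0 X0 dd.
  have : 0 <= (d - 1) * ((2 * d - 1) * d - (X + 1)).
    by rewrite mulr_ge0//; [lra | nra].
  nra.
have -> : d = x ^+ 2 + y ^+ 2 + 1 by lra.
ring.
Qed.

(** The fibre matrices are real, so the real part of the form at a complex vector is the sum of one
    real form [q] at the real parts and at the imaginary parts. *)
Lemma S_densityE {R : realType} (d : R) (f g : R -> R[i]) (t : R)
    (x := Num.sqrt (t - 1)) (y := Num.sqrt (d - t))
    (q := fun p u => (x ^+ 2 + 2 * (1 - d)) * p ^+ 2 + x * y * (u * p)
                     + (2 * d - 1) * x ^+ 2 * u ^+ 2) :
  t \in `[1, d] ->
  x ^+ 2 + y ^+ 2 = d - 1 /\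
  S_density d f g t = q (complex.Re (f t)) (complex.Re (g t))
                      + q (complex.Im (f t)) (complex.Im (g t)).
Proof.
rewrite in_itv/= => /andP[t1 td].
have x2 : x ^+ 2 = t - 1 by rewrite sqr_sqrtr// subr_ge0.
have y2 : y ^+ 2 = d - t by rewrite sqr_sqrtr// subr_ge0.
split; first by rewrite x2 y2; ring.
have tI : t \in (`[1, d]%classic : set R) by rewrite inE/= in_itv/= t1.
rewrite /S_density !patchE tI /q x2 /sqnorm.
have -> : S_entry11 d t = t - (2 * d - 1)
  by rewrite -[LHS]/(t - (2 * d - 1) * 1) mulr1.
have -> : S_entry12 d t = x * y
  by rewrite -[LHS]/(x * Num.sqrt (d * 1 - t)) mulr1.
have -> : S_entry22 d t = (2 * d - 1) * (t - 1) by [].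
by case: (f t) (g t) => [p p'] [u u'] /=; ring.
Qed.

Lemma S_density_out {R : realType} (d : R) (f g : R -> R[i]) (t : R) :
  t \notin `[1, d] -> S_density d f g t = 0.
Proof.
move=> tI; have {}tI : (t \in (`[1, d]%classic : set R)) = false.
  by apply: contraNF tI; rewrite inE.
by rewrite /S_density !patchE tI !mul0r !addr0.
Qed.

Lemma S_density_ge {R : realType} (d : R) (f g : R -> R[i]) (t : R) : 1 < d ->
  2 * (1 - d) * (sqnorm (f t) + sqnorm (g t)) <= S_density d f g t.
Proof.
move=> d1.
(* Outside [[1, d]] the density is zero while the bound is nonpositive, so no restriction on [t] is
   needed. *)
have [/S_densityE|/S_density_out ->] := boolP (t \in `[1, d]); last first.
  by rewrite -mulrA pmulr_rle0// nmulr_rle0 ?subr_lt0// addr_ge0 ?sqnorm_ge0.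
move=> /(_ f g)[xy ->].
apply: le_trans (lerD (fibre_form_ge _ _ _ _ _ d1 xy)
  (fibre_form_ge _ _ _ _ _ d1 xy)).
by rewrite /sqnorm le_eqVlt; apply/orP; left; apply/eqP; ring.
Qed.

(** The exception [t = d] is genuine: there [y = 0], the matrix is diagonal, and its second diagonal
    entry equals the bound. *)
Lemma S_density_gap {R : realType} (d : R) (f g : R -> R[i]) (t : R)
    (gap := (2 * d - 1) * (d - 1) * (sqnorm (f t) + sqnorm (g t))
            - S_density d f g t) :
  1 < d -> 0 <= gap /\ (gap = 0 -> t != d -> sqnorm (f t) + sqnorm (g t) = 0).
Proof.
move=> d1; rewrite /gap.
have r0 : 0 < 2 * d - 1 by lra.
have [tI|tI] := boolP (t \in `[1, d]); last first.
  rewrite S_density_out// subr0; split.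
    rewrite mulr_ge0 ?(addr_ge0 (sqnorm_ge0 _) (sqnorm_ge0 _))//.
    by rewrite mulr_ge0 ?ltW// subr_gt0.
  by move/eqP; rewrite !mulf_eq0 gt_eqF// subr_eq0 gt_eqF//= => /eqP.
have [xy ->] := S_densityE _ f g _ tI.
set x := Num.sqrt (t - 1); set y := Num.sqrt (d - t).
have [c c0 h] :=
  fibre_form_gap _ _ _ (complex.Re (f t)) (complex.Re (g t)) d1 xy.
have [c' c'0 h'] :=
  fibre_form_gap _ _ _ (complex.Im (f t)) (complex.Im (g t)) d1 xy.
move: h h'; rewrite /sqnorm -/x -/y.
case: (f t) (g t) => [p p'] [u u'] /=.
set F := (X in 4 * _ * X = _ -> _) => hF.
set F' := (X in 4 * _ * X = _ -> _) => hF'.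
rewrite (_ : _ - _ = F + F'); last by rewrite /F /F'; ring.
have r4 : 0 < 4 * (2 * d - 1) by lra.
have F0 : 0 <= F.
  by rewrite -(pmulr_rge0 _ r4) hF addr_ge0 ?sqr_ge0// mulr_ge0 ?sqr_ge0// ltW.
have F'0 : 0 <= F'.
  by rewrite -(pmulr_rge0 _ r4) hF' addr_ge0 ?sqr_ge0// mulr_ge0 ?sqr_ge0// ltW.
split; first exact: addr_ge0.
move/eqP; rewrite paddr_eq0// => /andP[/eqP FE /eqP F'E] td.
have y0 : y != 0.
  move: tI td; rewrite in_itv/= => /andP[_ td] td'.
  by rewrite sqrtr_eq0 -ltNge subr_gt0 lt_neqAle td'.
have null (c1 p1 u1 : R) : 0 < c1 ->
    0 = (2 * (2 * d - 1) * y * u1 - x * p1) ^+ 2 + c1 * p1 ^+ 2 ->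
    p1 = 0 /\ u1 = 0.
  move=> c10 /esym/eqP; rewrite paddr_eq0 ?sqr_ge0//; last
    by rewrite mulr_ge0 ?sqr_ge0// ltW.
  rewrite sqrf_eq0 => /andP[+].
  rewrite mulf_eq0 (gt_eqF c10)//= sqrf_eq0 => + /eqP p10.
  rewrite p10 mulr0 subr0 !mulf_eq0 (negPf y0) (gt_eqF r0) pnatr_eq0 /=.
  by move/eqP->.
move: hF hF'; rewrite FE F'E mulr0 => /null -[]// -> -> /null -[]// -> ->.
by rewrite !expr0n !addr0.
Qed.

(** * Bounds for the real part on the numerical range *)

Lemma S_unitE {R : realType} (d : R) (x : S_space d) :
  ip_norm (S_ip d) x = 1 -> S_ip d x x = 1.
Proof.
move=> x1.
by rewrite -[LHS]sqrtCK -[sqrtC _]/(ip_norm (S_ip d) x) x1 expr1n.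
Qed.

Lemma integrable_sqnormD {R : realType} {d : R}
    (f g : sqint (lebesgue_on 1 d)) :
  (lebesgue_on 1 d).-integrable setT
    (EFin \o (fun t => sqnorm (f t) + sqnorm (g t))).
Proof.
exact: (integrableD measurableT (integrable_sqnorm f) (integrable_sqnorm g)).
Qed.

Lemma integrableZ_sqnormD {R : realType} {d : R} (k : R)
    (f g : sqint (lebesgue_on 1 d)) :
  (lebesgue_on 1 d).-integrable setT
    (EFin \o (fun t => k * (sqnorm (f t) + sqnorm (g t)))).
Proof. exact: (integrableZl measurableT k (integrable_sqnormD f g)). Qed.

(** Both bounds concern real parts only, so they need no more than these two real identities about a
    point of the numerical range. *)
Lemma numerical_range_Re {R : realType} (d : R) (z : R[i]) :
  numerical_range (S_ip d) (S_op d) z ->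
  exists a b (f g : sqint (lebesgue_on 1 d)),
  sqnorm a + sqnorm b
    + \int[lebesgue_on 1 d]_t (sqnorm (f t) + sqnorm (g t)) = 1 /\
  complex.Re z = 2 * (1 - d) * sqnorm a
    + \int[lebesgue_on 1 d]_t S_density d f g t.
Proof.
case=> x /S_unitE x1 zE; move: x1 zE.
have [a [b [f [g ->]]]] := S_vectorP d x => x1 zE.
exists a, b, f, g; split.
  exact: etrans (esym (Re_S_ip_diag d a b f g)) (congr1 (@complex.Re R) x1).
exact: etrans (congr1 (@complex.Re R) (esym zE)) (Re_S_ip_op d a b f g).
Qed.

Lemma numerical_range_Re_ge {R : realType} (d : R) (z : R[i]) : 1 < d ->
  numerical_range (S_ip d) (S_op d) z -> 2 * (1 - d) <= complex.Re z.
Proof.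
move=> d1 /numerical_range_Re[a [b [f [g [x1 ->]]]]].
(* The bound is multiplied by the squared norm 1 and compared summand by summand: the first agrees
   exactly, the second contributes 0 against a nonpositive term, and the integrals compare
   pointwise. *)
rewrite -[leLHS]mulr1 -[X in _ * X <= _]x1 (mulrDr _ (sqnorm a + _)).
rewrite (mulrDr _ (sqnorm a)) -addrA lerD2l.
have b0 : 2 * (1 - d) * sqnorm b <= 0.
  by rewrite -mulrA pmulr_rle0// nmulr_rle0 ?subr_lt0// sqnorm_ge0.
apply: (@le_trans _ _ (\int[lebesgue_on 1 d]_t
    (2 * (1 - d) * (sqnorm (f t) + sqnorm (g t))))).
  by rewrite RintegralZl ?gerDr//; exact: integrable_sqnormD.
apply: le_Rintegral => //.
- exact: integrableZ_sqnormD.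
- exact: integrable_S_density.
- by move=> t _; exact: S_density_ge.
Qed.

Lemma lebesgue_on_ae_neq {R : realType} (a b c : R) :
  \forall t \ae lebesgue_on a b, t != c.
Proof.
exists [set c]; split; first exact: measurable_set1.
  apply: (@subset_measure0 _ _ _ (@lebesgue_measure R) _ [set c]) => //.
  - by apply: measurableI => //; exact: measurable_set1.
  - exact: lebesgue_measure_set1.
by move=> t /= /negP; rewrite negbK => /eqP.
Qed.

Lemma numerical_range_Re_lt {R : realType} (d : R) (z : R[i]) : 1 < d ->
  numerical_range (S_ip d) (S_op d) z -> complex.Re z < (2 * d - 1) * (d - 1).
Proof.
move=> d1 /numerical_range_Re[a [b [f [g [x1 ->]]]]].
set K := (2 * d - 1) * (d - 1).
have K0 : 0 < K by rewrite mulr_gt0//; lra.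
set n := fun t => sqnorm (f t) + sqnorm (g t).
pose gap t := K * n t - S_density d f g t.
have gap0 t : 0 <= gap t by have [] := S_density_gap d f g t d1.
have igap : (lebesgue_on 1 d).-integrable setT (EFin \o gap).
  exact: (integrableB measurableT (integrableZ_sqnormD K f g)
    (integrable_S_density d f g)).
have gapE : \int[lebesgue_on 1 d]_t gap t =
    K * \int[lebesgue_on 1 d]_t n t - \int[lebesgue_on 1 d]_t S_density d f g t.
  rewrite RintegralB ?RintegralZl//.
  - exact: integrable_sqnormD.
  - exact: integrableZ_sqnormD.
  - exact: integrable_S_density.
rewrite -subr_gt0.
(* Multiplying [K] by the squared norm 1 splits the difference into three nonnegative terms. If
   their sum were zero, [a] and [b] would vanish, and [f] and [g] almost everywhere, against the
   norm being 1. *)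
have -> : K - (2 * (1 - d) * sqnorm a
               + \int[lebesgue_on 1 d]_t S_density d f g t) =
   (K + 2 * (d - 1)) * sqnorm a + K * sqnorm b + \int[lebesgue_on 1 d]_t gap t.
  rewrite gapE -[K in LHS]mulr1 -[X in K * X - _]x1 -/n; ring.
have A0 : 0 <= (K + 2 * (d - 1)) * sqnorm a.
  by rewrite mulr_ge0 ?sqnorm_ge0//; lra.
have B0 : 0 <= K * sqnorm b by rewrite mulr_ge0 ?sqnorm_ge0// ltW.
have G0 : 0 <= \int[lebesgue_on 1 d]_t gap t by exact: Rintegral_ge0.
rewrite lt_neqAle !addr_ge0// andbT eq_sym; apply/negP.
rewrite !paddr_eq0 ?addr_ge0// => /andP[/andP[a0 b0] /eqP int0].
have {}a0 : sqnorm a = 0.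
  by apply/eqP; move: a0; rewrite mulf_eq0 gt_eqF//; lra.
have {}b0 : sqnorm b = 0 by apply/eqP; move: b0; rewrite mulf_eq0 gt_eqF.
have gap_ae : ae_eq (lebesgue_on 1 d) setT (EFin \o gap) (cst 0%E).
  have /integrableP[mgap _] := igap.
  apply/(ae_eq_integral_abs _ measurableT mgap).
  under eq_integral do rewrite gee0_abs ?lee_fin//.
  by rewrite -[LHS]fineK ?integrable_fin_num// -[fine _]/(Rintegral _ _ _) int0.
have n_ae : ae_eq (lebesgue_on 1 d) setT (EFin \o n) (cst 0%E).
  apply: filterS2 gap_ae (lebesgue_on_ae_neq 1 d d) => t /(_ I) [gapt0] td _ /=.
  by have [_ /(_ gapt0 td)] := S_density_gap d f g t d1; rewrite /n => ->.
have n0 : \int[lebesgue_on 1 d]_t n t = 0.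
  rewrite /Rintegral (ae_eq_integral (cst 0%E))//; first by rewrite integral0.
  by have /integrableP[] := integrable_sqnormD f g.
by move: x1; rewrite a0 b0 -/n n0 !addr0 => /esym/eqP; rewrite oner_eq0.
Qed.

(** * Values of the numerical range near the upper bound *)

Lemma indic_Lfun {R : realType} {d} {T : measurableType d}
    {mu : {measure set T -> \bar R}} (A : set T) :
  measurable A -> (mu A < +oo)%E -> (\1_A : T -> R) \in Lfun mu 2.
Proof.
move=> mA muA; rewrite inE; apply/andP; split; rewrite inE /=.
  exact: measurable_indic.
rewrite /finite_norm unlock; apply: poweR_lty.
rewrite (eq_integral (fun t => (\1_A t)%:E)) ?integral_indic ?setIT// => t _.
by rewrite abse_EFin poweR_EFin !indicE; case: (_ \in _);
  rewrite ?normr1 ?powR1 ?normr0 ?powR0 ?pnatr_eq0.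
Qed.

Lemma real_complex_Lfun {R : realType} {d} {T : measurableType d}
    {mu : {measure set T -> \bar R}} (u : T -> R) :
  u \in Lfun mu 2 -> (fun t => (u t)%:C%C) \in complex_Lfun mu 2.
Proof.
move=> uL; apply/andP; split; first exact: uL.
by have [] := Lfun_submod_closed mu (lee1n 2).
Qed.

Lemma lebesgue_on_itv {R : realType} (a b e : R) : 0 < e -> e <= b - a ->
  lebesgue_on a b `[b - e, b]%classic = e%:E.
Proof.
move=> e0 eab; rewrite /lebesgue_on /mrestr.
transitivity (lebesgue_measure (`[b - e, b]%classic : set R)).
  congr lebesgue_measure.
  apply/setIidl => t /=; rewrite !in_itv /= => /andP[h ->]; rewrite andbT.
  by apply: le_trans h; lra.
rewrite lebesgue_measure_itv /= lte_fin ifT; last lra.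
by rewrite -EFinB; congr EFin; ring.
Qed.

Lemma complex_integral_real {R : realType} {d} {T : measurableType d}
    (mu : {measure set T -> \bar R}) (u : T -> R) :
  complex_integral mu (fun t => (u t)%:C%C) = (\int[mu]_t u t)%:C%C.
Proof.
congr (_ +i* _)%C => /=.
by rewrite /Rintegral integral0.
Qed.

(** The witness has [g] equal to the indicator of [[d - e, d]], scaled to norm 1, and all other
    components zero. Only the entry [S_entry22] then contributes, and the value is the average of
    [(2 * d - 1) * (t - 1)] over that interval, where [t] is at least [d - e]. *)
Lemma numerical_range_near {R : realType} (d e : R) :
  1 < d -> 0 < e -> e <= d - 1 ->
  exists2 v : R, numerical_range (S_ip d) (S_op d) v%:C%C &
    (2 * d - 1) * (d - e - 1) <= v.
Proof.
move=> d1 e0 ed.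
pose A := `[d - e, d]%classic : set R.
have muA : lebesgue_on 1 d A = e%:E by exact: lebesgue_on_itv.
have mA : measurable (A : set (measurableTypeR R)) by exact: measurable_itv.
have AL : (\1_A : R -> R) \in Lfun (lebesgue_on 1 d) 2
  by apply: indic_Lfun => //; rewrite muA ltry.
have intA : (\int[lebesgue_on 1 d]_t (\1_A t)%:E = e%:E)%E.
  by rewrite integral_indic// -muA; congr (lebesgue_on 1 d _); rewrite setIT.
pose c := Num.sqrt e^-1.
have c2 : c ^+ 2 = e^-1 by rewrite sqr_sqrtr// invr_ge0 ltW.
pose g := c%:C%C *: SqInt (real_complex_Lfun _ AL) : sqint (lebesgue_on 1 d).
have gE t : g t = (c * \1_A t)%:C%C by rewrite rmorphM.
have gn t : sqnorm (g t) = e^-1 * \1_A t.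
  rewrite gE /sqnorm /= expr0n addr0 exprMn c2 indicE.
  by case: (_ \in _); rewrite ?expr1n ?expr0n.
have n1 : \int[lebesgue_on 1 d]_t sqnorm (g t) = 1.
  rewrite /Rintegral; under eq_integral do rewrite gn EFinM.
  rewrite ge0_integralZl//.
  - by rewrite intA -EFinM mulVf// gt_eqF.
  - exact/measurable_EFinP/measurable_indic.
  - by rewrite lee_fin invr_ge0 ltW.
(* The zero function is kept abstract and known only through its values. *)
have [f f0] : exists f : sqint (lebesgue_on 1 d), forall t, f t = 0 by exists 0.
have x1 : S_ip d (S_vector 0 0 f g) (S_vector 0 0 f g) = 1.
  rewrite S_ip_diagE !mul0r !add0r.
  have -> : (fun t => f t * Num.conj (f t)) = fun t => (cst 0 t)%:C%C.
    by apply/funext => t; rewrite f0 mul0r.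
  rewrite (_ : (fun t => g t * _) = fun t => (sqnorm (g t))%:C%C); last first.
    apply/funext => t; rewrite gE /sqnorm /=.
    by apply/eqP; rewrite eq_complex /=; apply/andP; split; apply/eqP; ring.
  by rewrite !complex_integral_real n1 /Rintegral integral0 add0r.
pose v := \int[lebesgue_on 1 d]_t S_density d f g t.
have vE : S_ip d (S_op d (S_vector 0 0 f g)) (S_vector 0 0 f g) = v%:C%C.
  rewrite S_ip_opE mul0r mulr0 add0r.
  have -> : (fun t =>
      ((S_entry22 d \_ `[1, d]) t)%:C%C * g t * Num.conj (g t)) =
      fun t => (S_density d f g t)%:C%C.
    apply/funext => t; rewrite /S_density f0 gE /sqnorm /=.
    by apply/eqP; rewrite eq_complex /=; apply/andP; split; apply/eqP; ring.
  have -> : (fun t => (((S_entry11 d \_ `[1, d]) t)%:C%C * f t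
        + ((S_entry12 d \_ `[1, d]) t)%:C%C * g t) * Num.conj (f t)) =
      fun t => (cst 0 t)%:C%C.
    by apply/funext => t; rewrite f0 rmorph0 mulr0.
  by rewrite !complex_integral_real /Rintegral integral0 add0r.
exists v.
  by exists (S_vector 0 0 f g) => //=; rewrite /ip_norm x1 sqrtC1.
rewrite -[leLHS]mulr1 -[X in _ * X <= _]n1 -RintegralZl//; last
  exact: integrable_sqnorm.
apply: le_Rintegral => //.
- exact: (integrableZl measurableT _ (integrable_sqnorm g)).
- exact: (integrable_S_density d f g).
move=> t _; rewrite /S_density gn f0 rmorph0 mulr0 /sqnorm /= expr0n /=.
rewrite addr0 !mulr0 !add0r indicE.
have [|_] := boolP (t \in A); last by rewrite !mulr0.
rewrite inE /A /= in_itv /= => /andP[t1 t2].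
rewrite patchE ifT; last by rewrite inE /= in_itv /= t2 andbT; lra.
apply: ler_wpM2r; first by rewrite mulr1 invr_ge0 ltW.
by rewrite -[leRHS]/((2 * d - 1) * (t - 1)); apply: ler_wpM2l; lra.
Qed.

(** * The leftmost point, and the failure of closedness and openness *)

Lemma ball_complex_real {R : realType} (x y e : R) :
  `|x - y| < e -> ball (x%:C%C : R[i]^o) e%:C%C (y%:C%C : R[i]^o).
Proof.
move=> xye; rewrite -ball_normE /= -rmorphB normc_def /= expr0n addr0.
by rewrite sqrtr_sqr ltcR.
Qed.

(** The basis vector of the first summand is a unit eigenvector for this value. *)
Lemma numerical_range_leftmost {R : realType} (d : R) :
  numerical_range (S_ip d) (S_op d) (2 * (1 - d))%:C%C.
Proof.
pose x : S_space d := ((1, 0), (0, 0)).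
have x1 : S_ip d x x = 1.
  rewrite -[LHS]/(scalar_ip 1 1 + scalar_ip 0 0 +
    (@L2_ip _ _ R (lebesgue_on 1 d) 0 0 + @L2_ip _ _ R (lebesgue_on 1 d) 0 0)).
  by rewrite !linear0l !addr0 /scalar_ip mul1r rmorph1.
have Sx : S_op d x = (2 * (1 - d))%:C%C *: x.
  transitivity (((2 * (1 - d))%:C%C *: (1 : R[i]^o), 0 : R[i]^o,
    (mul_op (@S_entry11_continuous R d) 0
     + mul_op (@S_entry12_continuous R d) 0,
     0 + mul_op (@S_entry22_continuous R d) 0)) : S_space d) => //.
  by rewrite !linear0 !addr0 /x; congr (_, _, (_, _)); rewrite scaler0.
exists x; first by rewrite /= /ip_norm x1 sqrtC1.
by rewrite Sx linearZl_LR /= x1 mulr1.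
Qed.

Theorem theorem4p17 (R : realType) (r : R) (hr : 1 < r) :
  let d := 2^-1 * (r + 1) in
  let W : set R[i]^o := numerical_range (S_ip d) (S_op d) in
  ~ closed W /\ ~ open W.
Proof.
move=> d W.
have d1 : 1 < d by rewrite /d; lra.
have nbhs_real (x : R) (B : set R[i]^o) : nbhs (x%:C%C : R[i]^o) B ->
    exists2 e : R, 0 < e & forall y, `|x - y| < e -> B y%:C%C.
  (* Radii of balls in [R[i]^o] are complex; being positive forces the imaginary part [e'] to be
     zero. *)
  case/nbhs_ballP => -[e e'] /=; rewrite ltcE /= => /andP[/eqP -> e0] eB.
  by exists e => // y xy; apply: eB; exact: ball_complex_real.
split.
- rewrite closure_id => cW.
  pose K := (2 * d - 1) * (d - 1).
  suff /(numerical_range_Re_lt _ _ d1) : W K%:C%C by rewrite /= ltxx.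
  rewrite cW => B /nbhs_real[e e0 eB].
  (* The bound [d - 1] keeps [[d - h, d]] inside [[1, d]]. The value obtained lies within
     [(2 * d - 1) * h] of [K], and [e / (4 * d)] makes this less than [e / 2]. *)
  pose h := Num.min (d - 1) (e / (4 * d)).
  have h0 : 0 < h by rewrite lt_min subr_gt0 d1 divr_gt0// mulr_gt0//; lra.
  have hd : h <= d - 1 by rewrite ge_min lexx.
  have he : (2 * d - 1) * h < e.
    have : h * (4 * d) <= e by rewrite -ler_pdivlMr ?ge_min ?lexx ?orbT//; lra.
    have : 0 < h * d by rewrite mulr_gt0//; lra.
    lra.
  have [v Wv vge] := numerical_range_near _ _ d1 h0 hd.
  exists v%:C%C; split => //; apply: eB.
  have /= vlt := numerical_range_Re_lt _ _ d1 Wv.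
  rewrite ger0_norm; last by rewrite subr_ge0 ltW.
  rewrite /K; lra.
- rewrite openE => /(_ _ (numerical_range_leftmost d)) /nbhs_real[e e0 eB].
  (* Openness would put the real point [e / 2] to the left of the minimum into [W]. *)
  have /eB : `|2 * (1 - d) - (2 * (1 - d) - e / 2)| < e.
    by rewrite opprB addrC subrK ger0_norm; lra.
  by move=> /(numerical_range_Re_ge _ _ d1) /=; lra.
Qed.
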